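(* Let $k$ be a field and let $a,b\in\mathbb{Z}_{>1}$ be coprime. If $\frac{a}{b}=[d_0;d_1,d_2,\ldots,d_n]$, then the plane curve $\mathbb{V}(x^b-y^a)\subset\mathbb{A}^2_k$ requires exactly $d_0+d_1+\cdots+d_n$ blow-ups to be resolved using the following algorithm: start with the single chart $\mathbb{A}^2$ with coordinates $x,y$; as long as there is a current chart in which the preimage of the curve is not resolved, blow up the origin of that chart, replacing the chart (with coordinates $f,g$) by the two standard charts of the blow-up, with coordinates $f,g/f$ and $g,f/g$; stop when the preimage of the curve is resolved in every chart.
   Context: $[d_0;d_1,\ldots,d_n]$ denotes the finite continued fraction $d_0+\cfrac{1}{d_1+\cfrac{1}{\ddots+\cfrac{1}{d_n}}}$ with $d_0\in\mathbb{Z}$ and $d_1,\ldots,d_n\in\mathbb{Z}_{>0}$. Each chart occurring in the algorithm is isomorphic to $\mathbb{A}^2$ with coordinates $f,g$ that are Laurent monomials in $x,y$, and maps to the original $\mathbb{A}^2$ by the composite of blow-up maps, corresponding to the inclusion $k[x,y]\subset k[f,g]$. The preimage of the curve in a chart means the full preimage under this map, including exceptional components, taken with its reduced irreducible components. A curve $C=C_1\cup\dots\cup C_m$ ($C_i$ its irreducible components) on a surface is resolved if (1) each $C_i$ is smooth; (2) no three components meet at a point; (3) no two components are tangent at any point, i.e. if $C_i$ and $C_j$ ($i\neq j$) meet at a point then their tangent lines there are different. *)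

(* Defs.v *)
From HB Require Import structures.
From mathcomp Require Export all_boot all_order all_algebra.
From mathcomp Require Export mpoly.
From mathcomp Require Import ring.

Set Implicit Arguments.
Unset Strict Implicit.
Unset Printing Implicit Defensive.

Import Order.TTheory GRing.Theory Num.Theory.
Local Open Scope ring_scope.

(* [d0; d1, ..., dn], with ds = [:: d1; ...; dn] *)
Fixpoint cfrac (d0 : int) (ds : seq int) : rat :=
  if ds is d1 :: ds' then d0%:~R + (cfrac d1 ds')^-1 else d0%:~R.

Section PlaneCurves.
Variable k : fieldType.

Definition plane_ring := {mpoly k[2]}.
Definition X0 : plane_ring := 'X_(ord0 : 'I_2).
Definition X1 : plane_ring := 'X_(ord_max : 'I_2).

Definition irreducible_mpoly (p : plane_ring) : Prop :=
  [/\ p != 0, p \isn't a GRing.unit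
    & forall q r : plane_ring, p = q * r -> q \is a GRing.unit \/ r \is a GRing.unit].

(* The reduced irreducible components of V(G), for G != 0, are the V(p) with p
   an irreducible factor of G; V(p) = V(q) exactly when the irreducible
   polynomials p and q differ by a nonzero constant. *)
Definition component (G p : plane_ring) : Prop :=
  irreducible_mpoly p /\ exists q : plane_ring, G = q * p.

Definition same_component (p q : plane_ring) : Prop :=
  exists2 c : k, c != 0 & q = c *: p.

(* Points of a curve are scheme-theoretic points, so they are represented by
   points with coordinates in arbitrary field extensions iota : k -> K. *)
Section Points.
Variables (K : fieldType) (iota : {rmorphism k -> K}).

Definition eval_at (P : 'I_2 -> K) (p : plane_ring) : K := (map_mpoly iota p).@[P].

Definition on_curve (p : plane_ring) (P : 'I_2 -> K) : Prop := eval_at P p = 0.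

Definition smooth_at (p : plane_ring) (P : 'I_2 -> K) : Prop :=
  exists i : 'I_2, eval_at P p^`M(i) != 0.

(* The direction vectors of the tangent line of V(p) at P *)
Definition tangent_line (p : plane_ring) (P : 'I_2 -> K) : pred 'rV[K]_2 :=
  [pred v : 'rV[K]_2 | \sum_(i < 2) eval_at P p^`M(i) * v ord0 i == 0].

End Points.

Definition smooth (p : plane_ring) : Prop :=
  forall (K : fieldType) (iota : {rmorphism k -> K}) (P : 'I_2 -> K),
    on_curve iota p P -> smooth_at iota p P.

Definition resolved (G : plane_ring) : Prop :=
  [/\ forall p, component G p -> smooth p,
      forall p q r,
        component G p -> component G q -> component G r ->
        ~ same_component p q -> ~ same_component p r -> ~ same_component q r ->
        forall (K : fieldType) (iota : {rmorphism k -> K}) (P : 'I_2 -> K),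
          ~ [/\ on_curve iota p P, on_curve iota q P & on_curve iota r P]
    & forall p q,
        component G p -> component G q -> ~ same_component p q ->
        forall (K : fieldType) (iota : {rmorphism k -> K}) (P : 'I_2 -> K),
          on_curve iota p P -> on_curve iota q P ->
          ~ (tangent_line iota p P =i tangent_line iota q P)].

(* A chart with coordinates f, g is given by the inclusion of k[x,y] in k[f,g]:
   the pair of the expressions of x and of y as polynomials in f = X0, g = X1. *)
Definition chart := (plane_ring * plane_ring)%type.

Definition plane : chart := (X0, X1).

(* The equation in the chart c of the full preimage of V(F) *)
Definition preimage (c : chart) (F : plane_ring) : plane_ring :=
  F \mPo [tuple c.1; c.2].

(* Rewriting in the coordinates (u, v) = (f, g/f), i.e. (f, g) = (u, u v),
   and in the coordinates (u, v) = (g, f/g), i.e. (f, g) = (u v, u) *)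
Definition subst_fst (p : plane_ring) : plane_ring := p \mPo [tuple X0; X0 * X1].
Definition subst_snd (p : plane_ring) : plane_ring := p \mPo [tuple X0 * X1; X0].

Definition blowup_fst (c : chart) : chart := (subst_fst c.1, subst_fst c.2).
Definition blowup_snd (c : chart) : chart := (subst_snd c.1, subst_snd c.2).

Definition pt (f g : k) : 'I_2 -> k := tnth [tuple f; g].

Lemma meval_subst_fst (p : plane_ring) (f g : k) :
  f != 0 -> (subst_fst p).@[pt f (g / f)] = p.@[pt f g].
Proof.
move=> f0; rewrite /subst_fst comp_mpoly_meval; apply: meval_eq => i.
rewrite /pt; case: i => [[|[|//]] lt_i]; rewrite !(tnth_nth 0) /=.
- by rewrite /X0 mevalXU !(tnth_nth 0).
- by rewrite mevalM !mevalXU !(tnth_nth 0) /=; field.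
Qed.

Lemma meval_subst_snd (p : plane_ring) (f g : k) :
  g != 0 -> (subst_snd p).@[pt g (f / g)] = p.@[pt f g].
Proof.
move=> g0; rewrite /subst_snd comp_mpoly_meval; apply: meval_eq => i.
rewrite /pt; case: i => [[|[|//]] lt_i]; rewrite !(tnth_nth 0) /=.
- by rewrite mevalM !mevalXU !(tnth_nth 0) /=; field.
- by rewrite /X0 mevalXU !(tnth_nth 0).
Qed.

(* [run F n s]: on V(F), the algorithm can have s as its list of current charts
   after n blow-ups (the order in which charts are treated is arbitrary). *)
Inductive run (F : plane_ring) : nat -> seq chart -> Prop :=
| run_start : run F 0 [:: plane]
| run_blowup n s1 c s2 :
    run F n (s1 ++ c :: s2) -> ~ resolved (preimage c F) ->
    run F n.+1 (s1 ++ [:: blowup_fst c, blowup_snd c & s2]).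

Definition all_resolved (F : plane_ring) (s : seq chart) : Prop :=
  forall c, c \in s -> resolved (preimage c F).

(* Some run stops after N blow-ups, no run is longer (so the algorithm always
   terminates), and every run that stops does so after exactly N blow-ups. *)
Definition requires_exactly (F : plane_ring) (N : nat) : Prop :=
  [/\ exists2 s, run F N s & all_resolved F s,
      forall n s, run F n s -> (n <= N)%N
    & forall n s, run F n s -> all_resolved F s -> n = N].

End PlaneCurves.

Arguments X0 {k}.
Arguments X1 {k}.

(* Main.v *)
(* In every chart the equation of the preimage of x^b - y^a is, up to a nonzero
   constant, a monomial f^e1 g^e2 times a binomial with coprime exponents (m, n):
   f^m - g^n or f^m g^n - 1.  Pulling back k[f,g] to k(t) along the generic point
   of a coprime binomial shows that it is prime, so the components are the axes of
   the monomial part and the binomial itself.  In the torus case f^m g^n - 1 the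
   preimage is resolved.  In the cusp case f^m - g^n (m, n > 0) it is not, since
   the exceptional components that earlier blow-ups have accumulated obstruct it
   even when m or n is 1; one of the two charts of the blow-up is then a cusp
   chart with exponents obtained by a step of the subtractive Euclidean algorithm,
   and the other is a torus chart (both are, if m = n = 1).  So the algorithm
   makes one blow-up per step of subtractive Euclid on (a, b), and the number of
   these steps is the sum of the partial quotients of a/b. *)
Require Import Defs.
From mathcomp Require Import fraction ring lra zify.

Set Implicit Arguments.
Unset Strict Implicit.
Unset Printing Implicit Defensive.

Import Order.TTheory GRing.Theory Num.Theory.
Local Open Scope ring_scope.

(** * Prime polynomials in two variables *)

Section PrimeFactors.
Variable k : fieldType.
Local Notation R2 := (plane_ring k).

Definition divides (p q : R2) : Prop := exists r, q = r * p.

(** Primality passes from a product to its factors; this is how the components of a monomial times a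
    binomial are found. *)
Definition prime_mpoly (p : R2) : Prop :=
  [/\ p != 0, p \isn't a GRing.unit
    & forall q r, divides p (q * r) -> divides p q \/ divides p r].

Lemma divides_sum (I : Type) (s : seq I) (P : pred I) (p : R2) (E : I -> R2) :
  (forall i, P i -> divides p (E i)) -> divides p (\sum_(i <- s | P i) E i).
Proof.
move=> dvdE; elim/big_ind: _ => // [|_ _ [q ->] [r ->]].
- by exists 0; rewrite mul0r.
- by exists (q + r); rewrite mulrDl.
Qed.

Lemma divides_mull (p q r : R2) : divides p q -> divides p (r * q).
Proof. by case=> s ->; exists (r * s); rewrite mulrA. Qed.

Lemma dividesZ (c : k) (p q : R2) : divides p q -> divides p (c *: q).
Proof. by rewrite -mul_mpolyC; apply: divides_mull. Qed.

Lemma mpoly2X (m : 'X_{1..2}) :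
  'X_[m] = X0 ^+ m ord0 * X1 ^+ m ord_max :> R2.
Proof.
rewrite mpolyXE_id big_ord_recl big_ord1.
have -> // : lift ord0 ord0 = ord_max :> 'I_2 by apply: val_inj.
Qed.

Lemma unit_mpolyP (p : R2) :
  reflect (exists2 c : k, c != 0 & p = c%:MP) (p \is a GRing.unit).
Proof.
apply: (iffP idP) => [/andP[/eqP pE u]|[c c0 ->]].
- by exists p@_0; rewrite -?unitfE.
- by apply/andP; rewrite mcoeffC eqxx mulr1 unitfE.
Qed.

Lemma irreducible_same_component (p q : R2) :
  p \isn't a GRing.unit -> irreducible_mpoly q -> divides p q -> same_component p q.
Proof.
move=> p_nu [_ _ irr_q] [r qE]; have [/unit_mpolyP[c c0 rE]|] := irr_q _ _ qE.
- by exists c => //; rewrite qE rE mul_mpolyC.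
- by rewrite (negPf p_nu).
Qed.

Lemma prime_irreducible (p : R2) : prime_mpoly p -> irreducible_mpoly p.
Proof.
case=> p0 p_nu prp; split=> // q r pE.
have [|[s sE]|[s sE]] := prp q r; first by exists 1; rewrite mul1r.
- right; apply/unitrP; exists s.
  have sr1 : s * r = 1 by apply: (mulfI p0); rewrite mulr1 {2}pE sE; ring.
  by split; rewrite // mulrC.
- left; apply/unitrP; exists s.
  have sr1 : s * q = 1 by apply: (mulfI p0); rewrite mulr1 {2}pE sE; ring.
  by split; rewrite // mulrC.
Qed.

(** Induction on [e]: if [s q = p^(e+1) r], then [p] divides [s], and one [p] cancels, or [p]
    divides the irreducible [q] and is associate to it. *)
Lemma prime_exp_divides (p q r : R2) (e : nat) :
  prime_mpoly p -> irreducible_mpoly q -> divides q (p ^+ e * r) ->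
  same_component p q /\ (0 < e)%N \/ divides q r.
Proof.
move=> prp irrq; have [p0 p_nu prp'] := prp.
elim: e => [|e IHe]; first by rewrite expr0 mul1r; right.
rewrite exprSr mulrAC => -[s sE].
have [|[t tE]|dpq] := prp' s q.
- by rewrite -sE; exists (p ^+ e * r).
- have [|[sc _]|] := IHe; [|by left|by right].
  by exists t; apply: (mulIf p0); rewrite sE tE mulrAC.
- by left; split=> //; apply: irreducible_same_component.
Qed.

End PrimeFactors.

(** * Evaluation at points over extension fields *)

Section Evaluation.
Variables (k : fieldType) (K : fieldType) (iota : {rmorphism k -> K}).
Variable (P : 'I_2 -> K).
Local Notation ev := (eval_at iota P).

Lemma eval_atD : {morph ev : p q / p + q}.
Proof. by move=> p q; rewrite /eval_at rmorphD mevalD. Qed.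

Lemma eval_atN : {morph ev : p / - p}.
Proof. by move=> p; rewrite /eval_at rmorphN mevalN. Qed.

Lemma eval_atM : {morph ev : p q / p * q}.
Proof. by move=> p q; rewrite /eval_at rmorphM mevalM. Qed.

Lemma eval_atC c : ev c%:MP = iota c.
Proof. by rewrite /eval_at map_mpolyC mevalC. Qed.

Lemma eval_atZ c p : ev (c *: p) = iota c * ev p.
Proof. by rewrite -mul_mpolyC eval_atM eval_atC. Qed.

Lemma eval_at1 : ev 1 = 1.
Proof. by rewrite -(mpolyC1 2 k) eval_atC rmorph1. Qed.

Lemma eval_at0 : ev 0 = 0.
Proof. by rewrite -(mpolyC0 2 k) eval_atC rmorph0. Qed.

Lemma eval_at_nat n : ev n%:R = n%:R.
Proof. by elim: n => [|n IHn]; rewrite ?eval_at0 // -!natr1 eval_atD IHn eval_at1. Qed.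

Lemma eval_atX p n : ev (p ^+ n) = ev p ^+ n.
Proof. by elim: n => [|n IHn]; rewrite ?expr0 ?eval_at1 // !exprS eval_atM IHn. Qed.

Lemma eval_atX0 : ev X0 = P ord0.
Proof. by rewrite /eval_at map_mpolyX mevalXU. Qed.

Lemma eval_atX1 : ev X1 = P ord_max.
Proof. by rewrite /eval_at map_mpolyX mevalXU. Qed.

Definition eval_atE :=
  
  (eval_at0, eval_at1, eval_at_nat, eval_atX0, eval_atX1, eval_atD, eval_atN, eval_atM,
   eval_atX, eval_atZ, eval_atC).

Lemma eval_at_sum (p : plane_ring k) :
  ev p = \sum_(m <- msupp p) iota p@_m * (P ord0 ^+ m ord0 * P ord_max ^+ m ord_max).
Proof.
rewrite {1}[p]mpolyE (big_morph ev eval_atD eval_at0).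
by apply: eq_bigr => m _; rewrite eval_atZ mpoly2X !eval_atE.
Qed.

End Evaluation.

Section CoordinatePrime.
Variable k : fieldType.
Local Notation R2 := (plane_ring k).

Lemma prime_X (i : 'I_2) : prime_mpoly ('X_i : R2).
Proof.
pose lq : 2.-tuple R2 := [tuple if j == i then 0 else 'X_j | j < 2].
have lqi : ('X_i : R2) \mPo lq = 0.
  by rewrite comp_mpolyXU -tnth_nth tnth_mktuple eqxx.
(* lq substitutes 0 for 'X_i; the kernel of this morphism is the ideal of 'X_i. *)
have dvdE (p : R2) : divides 'X_i p <-> p \mPo lq = 0.
  split=> [[q ->]|p0]; first by rewrite rmorphM /= lqi mulr0.
  rewrite -[p]subr0 -p0 comp_mpolyEX {1}[p]mpolyE -sumrB.
  apply: divides_sum => m _; rewrite -scalerBr; apply: dividesZ.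
  rewrite comp_mpolyX.
  (* A monomial involving the [i]-th variable is killed by [lq] and divisible by that variable; any
     other is fixed by [lq]. *)
  have [mi0|mi_gt0] := posnP (m i); last first.
    rewrite (bigD1 i) //= tnth_mktuple eqxx expr0n gtn_eqF // mul0r subr0.
    exists 'X_[m - U_(i)]; rewrite -mpolyXD submK //.
    by apply/mnm_lepP => j; rewrite mnm1E; case: eqP => // <-.
  rewrite [X in X - _]mpolyXE_id [X in _ - X](eq_bigr (fun j => 'X_j ^+ m j)) ?subrr.
    by exists 0; rewrite mul0r.
  by move=> j _; rewrite tnth_mktuple; case: eqP => // ->; rewrite mi0 !expr0.
split=> [||q r /dvdE].
- apply/eqP => /(congr1 (mcoeff U_(i)))/eqP.
  by rewrite mcoeffX eqxx mcoeff0 oner_eq0.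
- apply/negP => u; have: ('X_i : R2) \mPo lq \is a GRing.unit by exact: rmorph_unit.
  by rewrite lqi unitr0.
- by rewrite rmorphM => /eqP; rewrite mulf_eq0 => /orP[]/eqP/dvdE; [left|right].
Qed.

End CoordinatePrime.

(** * Primality of binomials with coprime exponents *)

Section BinomialPrime.
Variable k : fieldType.
Local Notation R2 := (plane_ring k).
Variables (u1 u2 v1 v2 : nat).
(** The two monomials share no variable; this covers both [X0^m - X1^n] and [X0^m X1^n - 1]. *)
Hypotheses (min1 : minn u1 v1 = 0%N) (min2 : minn u2 v2 = 0%N).
Let A : int := u1%:Z - v1%:Z.
Let B : int := u2%:Z - v2%:Z.
Hypothesis cop : coprimez A B.
Let H : R2 := X0 ^+ u1 * X1 ^+ u2 - X0 ^+ v1 * X1 ^+ v2.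
(** The power of t that the monomial becomes at the generic point [eta]. *)
Let wt (m : 'X_{1..2}) : int := B * (m ord0)%:Z - A * (m ord_max)%:Z.

Let tt : {fraction {poly k}} := FracField.tofrac 'X.
Let iota : {rmorphism k -> {fraction {poly k}}} := @FracField.tofrac {poly k} \o polyC.
(* The generic point (t^B, t^(-A)) of V(H) *)
Let eta (i : 'I_2) : {fraction {poly k}} := if i == ord0 then tt ^ B else tt ^ (- A).

Let tt0 : tt != 0. Proof. by rewrite tofrac_eq0 polyX_eq0. Qed.

Let eta_mon (i j : nat) : eta ord0 ^+ i * eta ord_max ^+ j = tt ^ (B * i%:Z - A * j%:Z).
Proof.
by rewrite /eta /= !exprnP !exprz_exp -expfzDr // mulNr.
Qed.

(* Monomials of equal weight differ by an integer multiple of (A, B), hence are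
   congruent modulo H. *)
Let divides_wt (m m' : 'X_{1..2}) :
  wt m = wt m' -> divides H ('X_[m] - 'X_[m']).
Proof.
(* The multiple is l = s x + t y, where (x, y) is the difference of the exponents. *)
have [s [t stE]] : exists s t : int, s * A + t * B = 1.
  by have [s [t]] := Bezoutz A B; move/eqP: cop => -> E; exists s, t.
(* Exchanging [m] and [m'] negates the multiple, so it may be taken nonnegative and used as an
   exponent. *)
wlog : m m' / 0 <= s * ((m ord0)%:Z - (m' ord0)%:Z) + t * ((m ord_max)%:Z - (m' ord_max)%:Z).
  move=> wl E.
  case: (lerP 0 (s * ((m ord0)%:Z - (m' ord0)%:Z) + t * ((m ord_max)%:Z - (m' ord_max)%:Z))) =>
    [|lt0]; first by move/wl; apply.
  have [] := wl m' m _ (esym E); first by lia.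
  by move=> q qE; exists (- q); rewrite mulNr -qE opprB.
pose x := (m ord0)%:Z - (m' ord0)%:Z; pose y := (m ord_max)%:Z - (m' ord_max)%:Z.
rewrite -/x -/y => l_ge0 wtE.
have BxAy : B * x = A * y by move: wtE; rewrite /wt /x /y; lia.
have [l lE] : exists l : nat, s * x + t * y = l%:Z.
  by exists `|(s * x + t * y)%R|%N; rewrite gez0_abs.
have xE : x = l%:Z * A.
  apply/eqP; rewrite -lE -subr_eq0.
  have -> : x - (s * x + t * y) * A = x * (1 - (s * A + t * B)) + t * (B * x - A * y).
    by ring.
  by rewrite stE BxAy !subrr !mulr0 addr0.
have yE : y = l%:Z * B.
  apply/eqP; rewrite -lE -subr_eq0.
  have -> : y - (s * x + t * y) * B = y * (1 - (s * A + t * B)) - s * (B * x - A * y).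
    by ring.
  by rewrite stE BxAy !subrr !mulr0 subr0.
(* One of [u1], [v1] is 0, so beyond their minimum the two exponents are [l u1] and [l v1]. Likewise
   for the other variable, so the difference is a monomial times a difference of [l]-th powers. *)
have [m0E m0E'] : m ord0 = (minn (m ord0) (m' ord0) + l * u1)%N /\
                  m' ord0 = (minn (m ord0) (m' ord0) + l * v1)%N.
  by move: xE min1; rewrite /x /A; clear; nia.
have [m1E m1E'] : m ord_max = (minn (m ord_max) (m' ord_max) + l * u2)%N /\
                  m' ord_max = (minn (m ord_max) (m' ord_max) + l * v2)%N.
  by move: yE min2; rewrite /y /B; clear; nia.
rewrite !mpoly2X m0E m1E [in X in _ - X]m0E' [in X in _ - X]m1E'.
move: (minn _ _) (minn _ _) => d c.
rewrite !exprD ![(l * _)%N]mulnC !exprM.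
rewrite [X in divides _ X](_ : _ =
  (X0 ^+ c * X1 ^+ d) * ((X0 ^+ u1 * X1 ^+ u2) ^+ l - (X0 ^+ v1 * X1 ^+ v2) ^+ l)); last first.
  by rewrite !exprMn; ring.
by apply: divides_mull; rewrite subrXX mulrC; eexists.
Qed.

(** At the generic point [p] becomes a Laurent polynomial in t, and this sum is its coefficient at
    [t^w]. *)
Let sum_wt_eq0 (p : R2) (w : int) : eval_at iota eta p = 0 ->
  \sum_(m <- msupp p | wt m == w) p@_m = 0.
Proof.
(* [D] bounds [w] and all weights in absolute value, so multiplication by [t^D] gives a true
   polynomial [q]. *)
move=> p0; pose D : nat := (\sum_(m <- msupp p) absz (wt m) + absz w)%N.
have D_ge m : m \in msupp p -> 0 <= wt m + D%:Z.
  move=> m_p; have : (absz (wt m) <= D)%N by rewrite /D (big_rem m) //= -addnA leq_addr.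
  by lia.
have w_ge : 0 <= w + D%:Z by rewrite /D; lia.
pose q : {poly k} := \sum_(m <- msupp p) p@_m *: 'X^`|(wt m + D%:Z)%R|%N.
have q0 : q = 0.
  apply/eqP; rewrite -tofrac_eq0 /q rmorph_sum /=; apply/eqP.
  transitivity (tt ^ D%:Z * eval_at iota eta p); last by rewrite p0 mulr0.
  rewrite eval_at_sum mulr_sumr [LHS]big_seq [RHS]big_seq; apply: eq_bigr => m m_p.
  rewrite -mul_polyC rmorphM rmorphXn /= -/tt eta_mon mulrCA -expfzDr //.
  by congr (_ * _); rewrite exprnP gez0_abs ?D_ge // addrC.
transitivity q`_`|(w + D%:Z)%R|%N; last by rewrite q0 coef0.
rewrite /q coef_sum big_mkcond /= [LHS]big_seq [RHS]big_seq; apply: eq_bigr => m /D_ge m_p.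
rewrite coefZ coefXn (_ : (_ == _ :> nat) = (wt m == w)); last by lia.
by case: eqP; rewrite ?mulr1 ?mulr0.
Qed.

(* Modulo H, each monomial m of p is replaced by the first monomial r m of p that
   has the same weight; the coefficients then cancel weight by weight. *)
Let divides_eval (p : R2) : eval_at iota eta p = 0 -> divides H p.
Proof.
move=> p0; pose r m := nth m (msupp p) (find (fun m' => wt m' == wt m) (msupp p)).
have wt_r m : m \in msupp p -> wt (r m) = wt m.
  move=> m_p; apply/eqP; rewrite /r.
  by apply: (@nth_find _ m (fun m' => wt m' == wt m)); apply/hasP; exists m.
have r_wt m m' : m \in msupp p -> m' \in msupp p -> wt m = wt m' -> r m = r m'.
  move=> m_p m'_p mm'; rewrite /r mm'; apply: set_nth_default.
  by rewrite -has_find; apply/hasP; exists m'.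
(* Subtracting this zero sum from [p] leaves differences of monomials of equal weight, each
   divisible by [H]. *)
suff sum0 : \sum_(m <- msupp p) p@_m *: 'X_[r m] = 0.
  rewrite -[p]subr0 -sum0 {1}[p]mpolyE -sumrB big_seq.
  apply: divides_sum => m m_p; rewrite -scalerBr; apply: dividesZ.
  by apply: divides_wt; rewrite wt_r.
apply/mpolyP => l; rewrite mcoeff0 raddf_sum /=.
under eq_bigr do rewrite mcoeffZ mcoeffX.
have [/mapP[m0 m0_p ->]|l_nr] := boolP (l \in map r (msupp p)); last first.
  rewrite big_seq big1 // => m m_p; case: eqP => [E|]; last by rewrite mulr0.
  by rewrite -E map_f in l_nr.
rewrite -[RHS](sum_wt_eq0 (wt m0) p0) [RHS]big_mkcond [LHS]big_seq [RHS]big_seq.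
apply: eq_bigr => m m_p /=.
have -> : (r m == r m0) = (wt m == wt m0).
  by apply/eqP/eqP => [E|/r_wt]; [rewrite -wt_r // E wt_r|apply].
by case: eqP; rewrite ?mulr1 ?mulr0.
Qed.

Let eval_H : eval_at iota eta H = 0.
Proof.
rewrite !eval_atE !eta_mon; apply/eqP; rewrite subr_eq0; apply/eqP.
by congr (_ ^ _); rewrite /A /B; ring.
Qed.

(** The multiples of [H] are exactly the polynomials that vanish at the generic point, hence the
    kernel of a morphism to a field. *)
Lemma prime_binomial : prime_mpoly H.
Proof.
have eval_div p : divides H p -> eval_at iota eta p = 0.
  by case=> q ->; rewrite eval_atM eval_H mulr0.
split=> [||q r /eval_div].
(* If [H] were 0, its two monomials would coincide and [A = B = 0] would contradict coprimality. *)
- apply/eqP => H0; pose mon i j := [multinom (if x == ord0 then i else j) | x < 2].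
  have monE i j : 'X_[mon i j] = X0 ^+ i * X1 ^+ j :> R2 by rewrite mpoly2X !mnmE.
  have: H@_(mon u1 u2) = 0 by rewrite H0 mcoeff0.
  rewrite /H -!monE mcoeffB !mcoeffX eqxx; case: eqP => [|_ /eqP]; last first.
    by rewrite subr0 oner_eq0.
  move/mnmP => E; have := E ord0; have := E ord_max; rewrite !mnmE /= => E2 E1.
  by move: cop; rewrite /A /B E1 E2 !subrr.
- by apply/negP => /unit_mpolyP[c /negPf c0 HE]; move/eqP: eval_H;
    rewrite HE eval_atC fmorph_eq0 c0.
- by rewrite eval_atM => /eqP; rewrite mulf_eq0 => /orP[]/eqP/divides_eval; [left|right].
Qed.

End BinomialPrime.

(** * Components and resolved preimages *)

Section Derivatives.
Variables (k K : fieldType) (iota : {rmorphism k -> K}) (P : 'I_2 -> K).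
Local Notation R2 := (plane_ring k).
Local Notation ev := (eval_at iota P).

Lemma mderiv_exp (i : 'I_2) (p : R2) (e : nat) :
  (p ^+ e)^`M(i) = e%:R * p ^+ e.-1 * p^`M(i).
Proof.
elim: e => [|e IHe]; first by rewrite expr0 -(mpolyC1 2 k) mderivC !mul0r.
rewrite exprS mderivM IHe /=; case: e {IHe} => [|e]; first by rewrite !expr0; ring.
by rewrite exprS -[e.+2%:R]natr1; ring.
Qed.

Lemma mderivU (i j : 'I_2) : ('X_i : R2)^`M(j) = (i == j)%:R.
Proof.
rewrite mderivX mnm1E; case: eqP => [->|_]; last by rewrite mulr0n scale0r.
by rewrite mulr1n scale1r (_ : (U_(j) - U_(j))%MM = 0%MM) ?mpolyX0 //; apply/mnmP => l;
  rewrite mnmBE mnm0E subnn.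
Qed.

Lemma mderiv_X0 (j : 'I_2) : (X0 : R2)^`M(j) = (ord0 == j)%:R.
Proof. exact: mderivU. Qed.

Lemma mderiv_X1 (j : 'I_2) : (X1 : R2)^`M(j) = (ord_max == j)%:R.
Proof. exact: mderivU. Qed.

Definition mderivE :=
  (mderivB, mderivM, mderiv_exp, mderiv_X0, mderiv_X1).

Lemma mem_tangent_line (p : R2) (v : 'rV[K]_2) :
  (v \in tangent_line iota p P) = (\sum_(i < 2) ev p^`M(i) * v ord0 i == 0).
Proof. by []. Qed.

Lemma mem_tangent_delta (p : R2) (j : 'I_2) :
  (delta_mx ord0 j \in tangent_line iota p P) = (ev p^`M(j) == 0).
Proof.
rewrite mem_tangent_line (bigD1 j) //= big1 => [|i /negPf ij]; last by rewrite mxE ij andbF mulr0.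
by rewrite mxE !eqxx mulr1 addr0.
Qed.

(** Tangent lines are told apart by the coordinate vectors in them, that is, by which partial
    derivatives vanish. *)
Lemma eq_tangent_line (p q : R2) :
  tangent_line iota p P =i tangent_line iota q P ->
  forall j, (ev p^`M(j) == 0) = (ev q^`M(j) == 0).
Proof. by move=> E j; have := E (delta_mx ord0 j); rewrite !mem_tangent_delta. Qed.

End Derivatives.

(** * Components up to nonzero constant factors *)

Section SameComponent.
Variable k : fieldType.
Local Notation R2 := (plane_ring k).

Lemma same_component_sym (p q : R2) : same_component p q -> same_component q p.
Proof.
by case=> c c0 ->; exists c^-1; rewrite ?invr_eq0 // scalerA mulVf // scale1r.
Qed.

Lemma same_component_trans (p q r : R2) :
  same_component p q -> same_component q r -> same_component p r.
Proof.
by case=> c c0 -> [d d0 ->]; exists (d * c); rewrite ?mulf_neq0 // scalerA.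
Qed.

Lemma same_component_on_curve (p q : R2) (K : fieldType) (iota : {rmorphism k -> K}) P :
  same_component p q -> on_curve iota q P -> on_curve iota p P.
Proof.
case=> c c0 ->; rewrite /on_curve eval_atZ => /eqP.
by rewrite mulf_eq0 fmorph_eq0 (negPf c0) => /eqP.
Qed.

Lemma same_component_tangent (p q : R2) (K : fieldType) (iota : {rmorphism k -> K}) P :
  same_component p q -> tangent_line iota q P =i tangent_line iota p P.
Proof.
case=> c c0 -> v; rewrite !mem_tangent_line.
have -> : \sum_(i < 2) eval_at iota P (c *: p)^`M(i) * v ord0 i
        = iota c * \sum_(i < 2) eval_at iota P p^`M(i) * v ord0 i.
  by rewrite mulr_sumr; apply: eq_bigr => i _; rewrite mderivZ eval_atZ mulrA.
by rewrite mulf_eq0 fmorph_eq0 (negPf c0).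
Qed.

Lemma same_component_smooth (p q : R2) : same_component p q -> smooth p -> smooth q.
Proof.
move=> pq smp K iota P /(same_component_on_curve pq)/smp[i].
case: pq => c c0 ->; exists i.
by rewrite mderivZ eval_atZ mulf_neq0 // fmorph_eq0.
Qed.

Lemma componentZ (s : k) (G p : R2) : s != 0 -> component (s *: G) p <-> component G p.
Proof.
move=> s0; split=> -[irr [q qE]]; split=> //; last by exists (s *: q); rewrite qE scalerAl.
by exists (s^-1 *: q); rewrite -scalerAl -qE scalerA mulVf // scale1r.
Qed.

Lemma resolvedZ (s : k) (G : R2) : s != 0 -> resolved (s *: G) <-> resolved G.
Proof.
move=> s0; have cE p := componentZ G p s0.
by split=> -[smG tripG tanG]; split=> [p /cE|p q r /cE Gp /cE Gq /cE Gr|p q /cE Gp /cE Gq];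
  [exact: smG|exact: tripG|exact: tanG|exact: smG|exact: tripG|exact: tanG].
Qed.

Lemma component_X0 (e1 e2 : nat) (h : R2) :
  (0 < e1)%N -> component (X0 ^+ e1 * X1 ^+ e2 * h) X0.
Proof.
case: e1 => // e1 _; split; first exact/prime_irreducible/prime_X.
by exists (X0 ^+ e1 * X1 ^+ e2 * h); rewrite exprS; ring.
Qed.

Lemma component_X1 (e1 e2 : nat) (h : R2) :
  (0 < e2)%N -> component (X0 ^+ e1 * X1 ^+ e2 * h) X1.
Proof.
case: e2 => // e2 _; split; first exact/prime_irreducible/prime_X.
by exists (X0 ^+ e1 * X1 ^+ e2 * h); rewrite exprS; ring.
Qed.

Lemma component_last (e1 e2 : nat) (h : R2) :
  prime_mpoly h -> component (X0 ^+ e1 * X1 ^+ e2 * h) h.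
Proof. by move=> /prime_irreducible; split=> //; exists (X0 ^+ e1 * X1 ^+ e2). Qed.

(* The possible components of V(X0 ^+ e1 * X1 ^+ e2 * h), h prime *)
Definition factor (h : R2) (o : option bool) : R2 :=
  if o is Some b then if b then X1 else X0 else h.

(** The primes [X0] and [X1] are stripped in turn; an irreducible divisor of what remains is
    associate to [h]. *)
Lemma component_factor (e1 e2 : nat) (h p : R2) :
  prime_mpoly h -> component (X0 ^+ e1 * X1 ^+ e2 * h) p ->
  exists o, same_component (factor h o) p.
Proof.
move=> prh [irrp]; rewrite -mulrA => dvdp.
have [[sc _]|] := prime_exp_divides (prime_X _ _) irrp dvdp; first by exists (Some false).
move=> {}dvdp.
have [[sc _]|] := prime_exp_divides (prime_X _ _) irrp dvdp; first by exists (Some true).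
move=> {}dvdp; exists None; apply: same_component_sym.
by apply: irreducible_same_component (prime_irreducible prh) dvdp; case: irrp.
Qed.

End SameComponent.

(** * Torus preimages are resolved, cusp preimages are not *)

Section Resolution.
Variable k : fieldType.
Local Notation R2 := (plane_ring k).
Implicit Types (m n e : nat).

Lemma prime_torus m n : coprime m n -> prime_mpoly (X0 ^+ m * X1 ^+ n - 1 : R2).
Proof.
move=> cop; have := @prime_binomial k m n 0 0; rewrite !expr0 mulr1; apply;
  rewrite ?minn0 ?min0n //.
by rewrite !subr0 coprimezE.
Qed.

Lemma prime_cusp m n : coprime m n -> prime_mpoly (X0 ^+ m - X1 ^+ n : R2).
Proof.
move=> cop; have := @prime_binomial k m 0 0 n; rewrite !expr0 mulr1 mul1r; apply;
  rewrite ?minn0 ?min0n //.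
by rewrite subr0 sub0r coprimezE abszN.
Qed.

(** Otherwise a Bezout relation would give 1 = 0 in [K]. This makes smoothness hold in every
    characteristic. *)
Lemma coprime_natr_neq0 (K : fieldType) m n :
  coprime m n -> (m%:R != 0 :> K) || (n%:R != 0 :> K).
Proof.
case: m => [|m]; first by rewrite /coprime gcd0n => /eqP->; rewrite oner_eq0 orbT.
move=> /eqP cop; case: (egcdnP n (ltn0Sn m)) => u v uvE _.
rewrite -negb_and; apply/negP => /andP[/eqP m0 /eqP n0].
have /eqP : (u * m.+1)%:R = (v * n + 1)%:R :> K by rewrite uvE cop.
by rewrite natrD !natrM m0 n0 !mulr0 add0r eq_sym oner_eq0.
Qed.

Lemma torus_on_curve m n (K : fieldType) (iota : {rmorphism k -> K}) P :
  on_curve iota (X0 ^+ m * X1 ^+ n - 1) P -> P ord0 ^+ m * P ord_max ^+ n = 1.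
Proof. by rewrite /on_curve !eval_atE => /eqP; rewrite subr_eq0 => /eqP. Qed.

(** Multiplying each partial derivative by its variable multiplies the monomial [X0^m X1^n] by its
    exponent, and that monomial is 1 on the curve. *)
Lemma deriv_torus m n (K : fieldType) (iota : {rmorphism k -> K}) P :
  on_curve iota (X0 ^+ m * X1 ^+ n - 1) P ->
  let d j := eval_at iota P (X0 ^+ m * X1 ^+ n - 1)^`M(j) in
  P ord0 * d ord0 = m%:R /\ P ord_max * d ord_max = n%:R.
Proof.
move=> /torus_on_curve P1 /=.
rewrite !mderivE /= -(mpolyC1 2 k) !mderivC !eval_atE /=.
rewrite !(mulr0, mul0r, mulr1, addr0, add0r, subr0).
split; rewrite -[RHS]mulr1 -P1.
- by case: m {P1} => [|m]; rewrite ?mul0r ?mulr0 // exprS /=; ring.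
- by case: n {P1} => [|n]; rewrite ?mul0r ?mulr0 // exprS /=; ring.
Qed.

Lemma smooth_torus m n : coprime m n -> smooth (X0 ^+ m * X1 ^+ n - 1 : R2).
Proof.
move=> cop K iota P /deriv_torus[d0 d1].
have [m0|n0] := orP (coprime_natr_neq0 K cop).
- by exists ord0; apply: contraNneq m0 => dP0; rewrite -d0 dP0 mulr0.
- by exists ord_max; apply: contraNneq n0 => dP0; rewrite -d1 dP0 mulr0.
Qed.

Lemma factor_neq (h p q : R2) o1 o2 :
  same_component (factor h o1) p -> same_component (factor h o2) q ->
  ~ same_component p q -> o1 != o2.
Proof.
move=> o1p o2q npq; apply/eqP => o12; apply: npq; rewrite -o12 in o2q.
exact: same_component_trans (same_component_sym o1p) o2q.
Qed.

(** The axes cross transversally. The binomial curve misses the axis of each variable with positive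
    exponent; if one exponent is 0, the other is 1, and the curve is a line parallel to one axis and
    transversal to the other. *)
Lemma resolved_torus e1 e2 m n : coprime m n ->
  resolved (X0 ^+ e1 * X1 ^+ e2 * (X0 ^+ m * X1 ^+ n - 1) : R2).
Proof.
move=> cop; set h := _ - 1.
have prh : prime_mpoly h := prime_torus cop.
split.
- move=> p /(component_factor prh)[o] /same_component_smooth; apply.
  case: o => [[|]|] /=; last exact: smooth_torus.
  + by move=> K iota P _; exists ord_max; rewrite mderiv_X1 eval_at1 oner_eq0.
  + by move=> K iota P _; exists ord0; rewrite mderiv_X0 eval_at1 oner_eq0.
- move=> p q r /(component_factor prh)[o1 o1p] /(component_factor prh)[o2 o2q].
  move=> /(component_factor prh)[o3 o3r] pq pr qr K iota P.
  have n12 := factor_neq o1p o2q pq; have n13 := factor_neq o1p o3r pr.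
  have n23 := factor_neq o2q o3r qr.
  case=> /(same_component_on_curve o1p) c1 /(same_component_on_curve o2q) c2
         /(same_component_on_curve o3r) c3.
  (* Three distinct labels exhaust [option bool], so [P] is the origin and also lies on the binomial
     curve, where the monomial would have to be 1. *)
  have on_all o : on_curve iota (factor h o) P.
    have: o \in [:: o1; o2; o3].
      by move: n12 n13 n23; clear; case: o o1 o2 o3 => [[]|] [[]|] [[]|] [[]|].
    by rewrite !inE => /or3P[] /eqP->.
  have P0 : P ord0 = 0 by have := on_all (Some false); rewrite /on_curve eval_atX0.
  have P1 : P ord_max = 0 by have := on_all (Some true); rewrite /on_curve eval_atX1.
  have /torus_on_curve/eqP := on_all None; rewrite P0 P1 !expr0n.
  by case: m n cop {h prh o1p o2q o3r c1 c2 c3 on_all} => [|m] [|n] // _;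
    rewrite ?(mulr0, mul0r) eq_sym oner_eq0.
- move=> p q /(component_factor prh)[o1 o1p] /(component_factor prh)[o2 o2q] pq K iota P.
  have n12 := factor_neq o1p o2q pq.
  move=> /(same_component_on_curve o1p) c1 /(same_component_on_curve o2q) c2 tE.
  have {tE} dE j : (eval_at iota P (factor h o1)^`M(j) == 0)
                 = (eval_at iota P (factor h o2)^`M(j) == 0).
    apply: eq_tangent_line => v; have t1 := same_component_tangent iota P o1p v.
    exact: etrans (esym t1) (etrans (tE v) (same_component_tangent iota P o2q v)).
  (* Tangency would give [n = 0] in [K]. But [m = 0] forces [n = 1], and [m > 0] makes the monomial
     vanish at [P]. *)
  have noX0 : on_curve iota X0 P -> on_curve iota h P ->
      (eval_at iota P (X0 : R2)^`M(ord_max) == 0)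
        = (eval_at iota P h^`M(ord_max) == 0) -> False.
    rewrite /on_curve eval_atX0 => P0 ch; rewrite mderiv_X0 eval_at0 eqxx => /esym/eqP dh.
    have [_] := deriv_torus ch; rewrite -/h dh mulr0; move/torus_on_curve: ch.
    rewrite P0; case: m cop {h prh dE o1p o2q c1 c2 dh} => [|m cop].
      by rewrite /coprime gcd0n => /eqP-> _ /eqP; rewrite eq_sym oner_eq0.
    by rewrite expr0n mul0r => /eqP; rewrite eq_sym oner_eq0.
  have noX1 : on_curve iota X1 P -> on_curve iota h P ->
      (eval_at iota P (X1 : R2)^`M(ord0) == 0)
        = (eval_at iota P h^`M(ord0) == 0) -> False.
    rewrite /on_curve eval_atX1 => P1 ch; rewrite mderiv_X1 eval_at0 eqxx => /esym/eqP dh.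
    have [+ _] := deriv_torus ch; rewrite -/h dh mulr0; move/torus_on_curve: ch.
    rewrite P1; case: n cop {h prh dE noX0 o1p o2q c1 c2 dh} => [|n cop].
      by rewrite /coprime gcdn0 => /eqP-> _ /eqP; rewrite eq_sym oner_eq0.
    by rewrite expr0n mulr0 => /eqP; rewrite eq_sym oner_eq0.
  have noX01 j : (eval_at iota P (X0 : R2)^`M(j) == 0)
               = (eval_at iota P (X1 : R2)^`M(j) == 0) -> False.
    rewrite mderiv_X0 mderiv_X1 !eval_at_nat.
    by case: j => [[|[|//]] lt_j]; rewrite /= ?mulr0n ?mulr1n oner_eq0 eqxx.
  have /= d0 := dE ord0; have /= d1 := dE ord_max.
  move: n12; case: o1 o2 d0 d1 c1 c2 {o1p o2q dE} => [[]|] [[]|] d0 d1 c1 c2 n12.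
  + by rewrite eqxx in n12.
  + exact: noX01 (esym d0).
  + exact: noX1 c1 c2 d0.
  + exact: noX01 d0.
  + by rewrite eqxx in n12.
  + exact: noX0 c1 c2 d1.
  + exact: noX1 c2 c1 (esym d0).
  + exact: noX0 c2 c1 (esym d1).
  + by rewrite eqxx in n12.
Qed.

(** The obstruction is at the origin: a triple point, a tangency with [X0 = 0], or a singularity. *)
Lemma not_resolved_cusp e1 e2 m n : (0 < m)%N -> (0 < n)%N -> coprime m n ->
  [\/ (0 < e1)%N /\ (0 < e2)%N, (0 < e1)%N /\ (1 < n)%N | (1 < m)%N /\ (1 < n)%N] ->
  ~ resolved (X0 ^+ e1 * X1 ^+ e2 * (X0 ^+ m - X1 ^+ n) : R2).
Proof.
move=> m_gt0 n_gt0 cop; set h := _ - _ ^+ n.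
have prh : prime_mpoly h := prime_cusp cop.
have ch := component_last e1 e2 prh.
pose O (i : 'I_2) : k := 0.
have hO : on_curve idfun h O.
  by rewrite /on_curve !eval_atE /O !expr0n !gtn_eqF // subr0.
have X0O : on_curve idfun (X0 : R2) O by rewrite /on_curve eval_atX0.
have X1O : on_curve idfun (X1 : R2) O by rewrite /on_curve eval_atX1.
have dh i : eval_at idfun O h^`M(i)
    = ((m == 1%N) && (i == ord0))%:R - ((n == 1%N) && (i == ord_max))%:R.
  have zE (a : nat) (b : bool) : (0 < a)%N ->
      a%:R * 0 ^+ a.-1 * b%:R = ((a == 1%N) && b)%:R :> k.
    by case: a b => [|[|a]] [] // _; rewrite expr0n /= ?mulr1 ?mulr0.
  by rewrite !mderivE !eval_atE /O !zE // ![_ == i]eq_sym.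
(* Components are separated by a point on one and off the other; (0,1) and (1,0) suffice. *)
have distinct (p q : R2) (P : 'I_2 -> k) : eval_at idfun P p = 0 -> eval_at idfun P q != 0 ->
    ~ same_component p q.
  by move=> p0 + [c c0 qE]; rewrite qE eval_atZ p0 mulr0 eqxx.
have singular : (1 < m)%N -> (1 < n)%N ->
    ~ resolved (X0 ^+ e1 * X1 ^+ e2 * h).
  move=> m1 n1 [smG _ _]; have [i] := smG _ ch _ idfun O hO.
  by rewrite dh !gtn_eqF // subrr eqxx.
have X0h : ~ same_component X0 h.
  apply: (distinct _ _ (fun i => (i == ord_max)%:R)); rewrite !eval_atE //= expr0n expr1n.
  by rewrite gtn_eqF // sub0r oppr_eq0 oner_eq0.
have X1h : ~ same_component X1 h.
  apply: (distinct _ _ (fun i => (i == ord0)%:R)); rewrite !eval_atE //= expr0n expr1n.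
  by rewrite gtn_eqF // subr0 oner_eq0.
have X0X1 : ~ same_component (X0 : R2) X1.
  apply: (distinct _ _ (fun i => (i == ord_max)%:R)); rewrite !eval_atE //=.
  exact: oner_neq0.
case=> [[e1_gt0 e2_gt0]|[e1_gt0 n1]|[m1 n1]]; last exact: singular.
- case=> _ tripG _; apply: (tripG X0 X1 h _ _ ch X0X1 X0h X1h k idfun O) => //.
  + exact: component_X0.
  + exact: component_X1.
(* For [m > 1] the curve is singular; for [m = 1] it is [f = g^n], with tangent line [f = 0] at the
   origin. *)
- have [m1|m1] := ltnP 1 m; first exact: singular.
  have {m1} mE : m = 1%N by lia.
  case=> _ _ tanG; apply: (tanG X0 h (component_X0 e2 h e1_gt0) ch X0h k idfun O X0O hO).
  move=> v; rewrite !mem_tangent_line; congr (_ == 0); apply: eq_bigr => i _; congr (_ * _).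
  rewrite dh mE /= gtn_eqF //= subr0 mderiv_X0 eval_at_nat.
  by rewrite eq_sym.
Qed.

End Resolution.

(** * Counting blow-ups *)

Section Algorithm.
Variables (k : fieldType) (F : plane_ring k).
Implicit Types (c : chart k) (s : seq (chart k)) (m n : nat).

(* [cost c n]: resolving the preimage in the chart c takes n blow-ups, counting
   those in the charts that the blow-up of c creates. *)
Inductive cost : chart k -> nat -> Prop :=
| cost_resolved c : resolved (preimage c F) -> cost c 0%N
| cost_blowup c m1 m2 : ~ resolved (preimage c F) ->
    cost (blowup_fst c) m1 -> cost (blowup_snd c) m2 -> cost c (m1 + m2).+1.

Inductive costs : seq (chart k) -> nat -> Prop :=
| costs_nil : costs [::] 0%N
| costs_cons c s m n : cost c m -> costs s n -> costs (c :: s) (m + n).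

Lemma costs_cat s1 s2 n1 n2 : costs s1 n1 -> costs s2 n2 -> costs (s1 ++ s2) (n1 + n2).
Proof. by elim=> //= c s m n cm _ IHs /IHs; rewrite -addnA; apply: costs_cons. Qed.

Lemma costs_catP s1 s2 n : costs (s1 ++ s2) n ->
  exists n1 n2, [/\ costs s1 n1, costs s2 n2 & n = (n1 + n2)%N].
Proof.
elim: s1 n => [|c s1 IHs] n /=; first by exists 0%N, n; split=> //; exact: costs_nil.
move En: (c :: s1 ++ s2) => t tn; case: t n / tn En => // c' s m n cm sn [cE sE].
rewrite -cE in cm; rewrite -sE in sn; have [n1 [n2 [s1n1 s2n2 ->]]] := IHs _ sn.
by exists (m + n1)%N, n2; split=> //; [exact: costs_cons|rewrite addnA].
Qed.

Lemma costs_consP c s n : costs (c :: s) n ->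
  exists m1 m2, [/\ cost c m1, costs s m2 & n = (m1 + m2)%N].
Proof.
move En: (c :: s) => t tn; case: t n / tn En => // c' s' m1 m2 cm sn [cE sE].
rewrite -cE in cm; rewrite -sE in sn; by exists m1, m2.
Qed.

Lemma costP c n : cost c n ->
  (resolved (preimage c F) /\ n = 0%N) \/
  exists m1 m2, [/\ ~ resolved (preimage c F), cost (blowup_fst c) m1,
                    cost (blowup_snd c) m2 & n = (m1 + m2).+1].
Proof. by case=> [c' res|c' m1 m2 nres c1 c2]; [left|right; exists m1, m2]. Qed.

(** Invariant of every run: blow-ups made plus outstanding cost equal [N], since a blow-up replaces
    a chart of cost [m1 + m2 + 1] by charts of costs [m1] and [m2]. *)
Lemma run_costs N n s : cost (plane k) N -> run F n s -> exists2 r, costs s r & (n + r = N)%N.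
Proof.
move=> costN; elim=> [|m s1 c s2 _ IHrun nres].
  by exists N => //; rewrite -[N]addn0; apply: costs_cons costN costs_nil.
have [r /costs_catP[n1 [n2 [s1n1 /costs_consP[l [n3 [/costP cl s2n3 n2E]]] rE]]] rN] := IHrun.
case: cl => [[]//|[m1 [m2 [_ c1 c2 lE]]]].
exists (n1 + (m1 + (m2 + n3)))%N; last by lia.
by apply: costs_cat => //; apply: costs_cons c1 _; apply: costs_cons c2 _.
Qed.

Lemma costs_all_resolved s r : costs s r -> all_resolved F s -> r = 0%N.
Proof.
elim=> // c t m n /costP cm _ IHt res; rewrite IHt => [|d dt].
- case: cm => [[_ ->]//|[m1 [m2 [[]]]]]; exact/res/mem_head.
- by apply: res; rewrite inE dt orbT.
Qed.

Lemma costs0_all_resolved s : costs s 0%N -> all_resolved F s.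
Proof.
move Er: 0%N => r sr; elim: sr Er => // c t [|m] [|n] //= /costP cm _ IHt _ d.
rewrite inE => /orP[/eqP->|/IHt]; last by apply.
by case: cm => [[]//|[m1 [m2 []]]].
Qed.

(** The derivation of a positive cost itself exhibits a chart to blow up next. *)
Lemma costs_unresolved s r : costs s r.+1 ->
  exists s1 c s2, s = s1 ++ c :: s2 /\ ~ resolved (preimage c F).
Proof.
move Er: r.+1 => r' sr; elim: sr r Er => // c t m n /costP cm _ IHt r rE.
case: cm => [[_ m0]|[m1 [m2 [nres _ _ _]]]]; last by exists [::], c, t.
rewrite m0 in rE; have [s1 [d [s2 [-> nres]]]] := IHt _ rE.
by exists (c :: s1), d, s2.
Qed.

(** By the invariant, a run can be continued while the outstanding cost is positive, and all its
    charts are resolved exactly when that cost is 0. *)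
Lemma cost_requires_exactly N : cost (plane k) N -> requires_exactly F N.
Proof.
move=> costN; split=> [|n s /(run_costs costN)[r _ <-]|n s].
- suff finish r : forall n s, run F n s -> costs s r -> (n + r = N)%N ->
      exists2 s, run F N s & all_resolved F s.
    apply: (finish N 0%N [:: plane k]) => //; first exact: run_start.
    by rewrite -[N]addn0; apply: costs_cons costN costs_nil.
  elim: r => [|r IHr] n s run_s cost_s nrN.
    by exists s; [rewrite -nrN addn0|exact: costs0_all_resolved].
  have [s1 [c [s2 [sE nres]]]] := costs_unresolved cost_s.
  rewrite sE in run_s; have run_s' := run_blowup run_s nres.
  have [r' cost_s' nrN'] := run_costs costN run_s'.
  by apply: IHr run_s' _ _; [have -> : r = r' by lia|lia].
- exact: leq_addr.
- by move=> /(run_costs costN)[r cost_s <-] /(costs_all_resolved cost_s)->; rewrite addn0.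
Qed.

End Algorithm.

(** * Continued fractions and the subtractive Euclidean algorithm *)

(* The steps of the subtractive Euclidean algorithm, with a last step (1, 1) -> 0 *)
Inductive euclid_steps : nat -> nat -> nat -> Prop :=
| euclid_steps1 : euclid_steps 1 1 1
| euclid_stepsl p q n : euclid_steps p q n -> euclid_steps (p + q) q n.+1
| euclid_stepsr p q n : euclid_steps p q n -> euclid_steps p (p + q) n.+1.

Lemma euclid_steps_sym p q n : euclid_steps p q n -> euclid_steps q p n.
Proof.
elim=> [|{}p {}q {}n _|{}p {}q {}n _]; first exact: euclid_steps1.
- by rewrite addnC; apply: euclid_stepsr.
- by rewrite addnC; apply: euclid_stepsl.
Qed.

Lemma euclid_steps_coprime p q n :
  euclid_steps p q n -> [/\ (0 < p)%N, (0 < q)%N & coprime p q].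
Proof.
elim=> // {}p {}q {}n _ [p_gt0 q_gt0 cop]; split=> //; rewrite ?addn_gt0 ?p_gt0 //.
- by rewrite coprime_sym /coprime gcdnDr gcdnC.
- by rewrite /coprime gcdnDl.
Qed.

Lemma cfrac_ge1 (d : int) (ds : seq int) :
  0 < d -> (forall d', d' \in ds -> 0 < d') -> 1 <= cfrac d ds.
Proof.
elim: ds d => [|d' ds IHds] d d_gt0 ds_gt0 /=; first by rewrite ler1z.
have le1 : 1 <= cfrac d' ds.
  by apply: IHds => [|e e_ds]; apply: ds_gt0; rewrite inE ?eqxx ?e_ds ?orbT.
rewrite -[1]addr0 lerD ?ler1z // invr_ge0; lra.
Qed.

Lemma cfracD (e d : int) (ds : seq int) : cfrac (d + e) ds = cfrac d ds + e%:~R.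
Proof. by case: ds => [|d' ds] /=; rewrite rmorphD /=; ring. Qed.

(** Strong induction on [p + q]. If [q < p], a step lowers [d0] by 1; if [p < q], then [d0 = 0], and
    inverting the fraction lets the step lower [d1]. The leading quotient may become 0, so only the
    later ones are assumed positive. *)
Lemma cfrac_euclid_steps p q (d0 : int) (ds : seq int) :
  (0 < p)%N -> (0 < q)%N -> coprime p q -> (forall d, d \in ds -> 0 < d) ->
  p%:R / q%:R = cfrac d0 ds ->
  exists2 N : nat, N%:Z = d0 + \sum_(d <- ds) d & euclid_steps p q N.
Proof.
have [n] := ubnP (p + q); elim: n => // n IHn in p q d0 ds * => le_n p0 q0 cop ds0 pqE.
have q0' : (q%:R : rat) != 0 by rewrite pnatr_eq0 -lt0n.
have p0' : (p%:R : rat) != 0 by rewrite pnatr_eq0 -lt0n.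
have [lt_qp|le_pq] := ltnP q p.
  have [||||||N NE st] := IHn (p - q)%N q (d0 - 1) ds; rewrite ?subn_gt0 //;
    first by clear -le_n q0 lt_qp; lia.
  - by move: cop; rewrite -{1}(subnK (ltnW lt_qp)) coprime_sym /coprime gcdnDr gcdnC.
  - by rewrite natrB ?(ltnW lt_qp) // cfracD -pqE; field.
  exists N.+1; first by lia.
  by rewrite -(subnK (ltnW lt_qp)); apply: euclid_stepsl.
(* With no further quotients [p/q] is an integer in (0,1], so [p = q = 1] by coprimality. *)
case: ds ds0 pqE => [|d1 ds] ds0 /= pqE.
  have pE : p%:Z = d0 * q%:Z.
    apply: (@intr_inj rat); rewrite rmorphM /= -pqE -!pmulrn.
    by rewrite divfK.
  have d01 : d0 = 1 by nia.
  have pq : p = q by lia.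
  move: cop; rewrite pq /coprime gcdnn => /eqP q1.
  by exists 1%N; rewrite ?big_nil ?d01 ?pq ?q1 //; apply: euclid_steps1.
have x_ge1 : 1 <= cfrac d1 ds.
  by apply: cfrac_ge1 => [|d d_ds]; apply: ds0; rewrite inE ?eqxx ?d_ds ?orbT.
have x0 : cfrac d1 ds != 0 by rewrite gt_eqF // (lt_le_trans ltr01).
have q_gt0 : (0 : rat) < q%:R by rewrite ltr0n.
have r_gt0 : (0 : rat) < p%:R / q%:R by rewrite divr_gt0 ?ltr0n.
have r_le1 : (p%:R / q%:R : rat) <= 1 by rewrite ler_pdivrMr // mul1r ler_nat.
have y_gt0 : 0 < (cfrac d1 ds)^-1 by rewrite invr_gt0 (lt_le_trans ltr01).
have y_le1 : (cfrac d1 ds)^-1 <= 1 by rewrite invf_le1 // (lt_le_trans ltr01).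
(* [d0] is a difference of two numbers in (0,1], hence an integer strictly between -1 and 1. *)
have d00 : d0 = 0.
  have d0E : d0%:~R = p%:R / q%:R - (cfrac d1 ds)^-1 by rewrite pqE addrK.
  move: (p%:R / q%:R) (cfrac d1 ds)^-1 d0E r_gt0 r_le1 y_gt0 y_le1
    => r y d0E r_gt0 r_le1 y_gt0 y_le1.
  have : (d0%:~R : rat) < 1%:~R by rewrite d0E; lra.
  have : ((-1)%:~R : rat) < d0%:~R by rewrite d0E rmorphN /=; lra.
  by rewrite !ltr_int; lia.
have xE : cfrac d1 ds = q%:R / p%:R.
  by rewrite -[LHS]invrK -invf_div; congr _^-1; rewrite pqE d00 add0r.
have [lt_pq|le_qp] := ltnP p q.
  have [||||||N NE st] := IHn (q - p)%N p (d1 - 1) ds; rewrite ?subn_gt0 //;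
    first by clear -le_n p0 lt_pq; lia.
  - by move: cop; rewrite -{1}(subnK (ltnW lt_pq)) /coprime gcdnDr gcdnC.
  - by move=> d d_ds; apply: ds0; rewrite inE d_ds orbT.
  - by rewrite natrB ?(ltnW lt_pq) // cfracD xE; field.
  exists N.+1; first by rewrite big_cons d00 add0r intS NE; ring.
  rewrite -[X in euclid_steps _ X](subnK (ltnW lt_pq)) addnC.
  exact/euclid_stepsr/euclid_steps_sym.
(* Here [p = q = 1] and the fraction starting at [d1] equals 1; as [d1 >= 1] and a tail would add a
   positive term, the expansion is [0;1]. *)
have pq : p = q by apply/eqP; rewrite eqn_leq le_pq.
move: cop; rewrite pq /coprime gcdnn => /eqP q1.
have {xE} : cfrac d1 ds = 1 by rewrite xE pq divff.
have d1_gt0 : 0 < d1 by apply: ds0; rewrite mem_head.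
have d1_ge1 : (1 : rat) <= d1%:~R by rewrite ler1z.
case: ds {IHn x_ge1 x0 y_gt0 y_le1 pqE} ds0 => [|d2 ds] ds0 /= d1E.
  exists 1%N; last by rewrite q1; apply: euclid_steps1.
  by rewrite big_cons big_nil d00 !add0r addr0; apply: (@intr_inj rat); rewrite d1E.
have : 0 < (cfrac d2 ds)^-1.
  rewrite invr_gt0 (lt_le_trans ltr01) // cfrac_ge1 // => [|d d_ds]; apply: ds0;
    by rewrite !inE ?eqxx ?d_ds ?orbT.
by move: d1E d1_ge1; lra.
Qed.

(** * Blow-ups of cusp charts *)

Section CuspCharts.
Variables (k : fieldType) (a b : nat).
Local Notation R2 := (plane_ring k).
Let F : R2 := X0 ^+ b - X1 ^+ a.
Implicit Types (c : chart k) (m n p q e : nat).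

Lemma subst_fstE (s : k) e1 e2 m n m' n' :
  subst_fst (s *: (X0 ^+ e1 * X1 ^+ e2 * (X0 ^+ m * X1 ^+ n - X0 ^+ m' * X1 ^+ n')))
  = s *: (X0 ^+ (e1 + e2) * X1 ^+ e2
          * (X0 ^+ (m + n) * X1 ^+ n - X0 ^+ (m' + n') * X1 ^+ n')).
Proof.
rewrite /subst_fst comp_mpolyZ !(rmorphM, rmorphB, rmorphXn) /=.
rewrite !comp_mpolyXU /= !exprMn !exprD; congr (_ *: _); ring.
Qed.

Lemma subst_sndE (s : k) e1 e2 m n m' n' :
  subst_snd (s *: (X0 ^+ e1 * X1 ^+ e2 * (X0 ^+ m * X1 ^+ n - X0 ^+ m' * X1 ^+ n')))
  = s *: (X0 ^+ (e1 + e2) * X1 ^+ e1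
          * (X0 ^+ (m + n) * X1 ^+ m - X0 ^+ (m' + n') * X1 ^+ m')).
Proof.
rewrite /subst_snd comp_mpolyZ !(rmorphM, rmorphB, rmorphXn) /=.
rewrite !comp_mpolyXU /= !exprMn !exprD; congr (_ *: _); ring.
Qed.

Lemma preimage_cusp c : preimage c F = c.1 ^+ b - c.2 ^+ a.
Proof. by rewrite /preimage rmorphB !rmorphXn /= !comp_mpolyXU. Qed.

Lemma preimage_blowup_fst c : preimage (blowup_fst c) F = subst_fst (preimage c F).
Proof. by rewrite !preimage_cusp /subst_fst rmorphB !rmorphXn. Qed.

Lemma preimage_blowup_snd c : preimage (blowup_snd c) F = subst_snd (preimage c F).
Proof. by rewrite !preimage_cusp /subst_snd rmorphB !rmorphXn. Qed.

(** The constant [s] absorbs the sign when a blow-up reverses the binomial. *)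
Definition torus_chart c m n : Prop :=
  exists s e1 e2, s != 0 /\
    preimage c F = s *: (X0 ^+ e1 * X1 ^+ e2 * (X0 ^+ m * X1 ^+ n - 1)).

(* The last condition makes the cusp unresolved even for m = 1 or n = 1: three
   components meet at the origin, or the curve f = g^n is tangent to the exceptional
   component f = 0, or the curve is singular.  It is inherited by blow-ups. *)
Definition cusp_chart c m n : Prop :=
  exists s e1 e2, [/\ s != 0,
    preimage c F = s *: (X0 ^+ e1 * X1 ^+ e2 * (X0 ^+ m - X1 ^+ n))
    & [\/ (0 < e1)%N /\ (0 < e2)%N, (0 < e1)%N /\ (1 < n)%N | (1 < m)%N /\ (1 < n)%N]].

Lemma cost_torus_chart c m n : coprime m n -> torus_chart c m n -> cost F c 0.
Proof.
move=> cop [s [e1 [e2 [s0 cE]]]]; apply: cost_resolved; rewrite cE.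
exact/(resolvedZ _ s0)/resolved_torus.
Qed.

Lemma cusp_chart_unresolved c m n :
  (0 < m)%N -> (0 < n)%N -> coprime m n -> cusp_chart c m n -> ~ resolved (preimage c F).
Proof.
move=> m0 n0 cop [s [e1 [e2 [s0 -> cond]]]] /(resolvedZ _ s0).
exact: not_resolved_cusp.
Qed.

Lemma cusp_binomial m n :
  X0 ^+ m - X1 ^+ n = X0 ^+ m * X1 ^+ 0 - X0 ^+ 0 * X1 ^+ n :> R2.
Proof. by rewrite !expr0 mulr1 mul1r. Qed.

(** [f^(p+q) - g^q] becomes [u^q (u^p - v^q)] for [(f,g) = (u,uv)] and [u^q (u^p v^(p+q) - 1)] for
    [(f,g) = (uv,u)]. *)
Lemma blowup_fst_gt c p q : cusp_chart c (p + q) q -> (0 < q)%N ->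
  cusp_chart (blowup_fst c) p q /\ torus_chart (blowup_snd c) p (p + q).
Proof.
move=> [s [e1 [e2 [s0 cE cond]]]] q0; rewrite cusp_binomial in cE.
split.
- exists s, (e1 + e2 + q)%N, e2; split=> //.
    rewrite preimage_blowup_fst cE subst_fstE; congr (_ *: _).
    by rewrite !addn0 !add0n !expr0 !exprD; ring.
  (* The exceptional exponent [e1 + e2 + q] is positive, and [n = q] is unchanged. *)
  by case: cond => -[h1 h2]; [apply: Or31|apply: Or32|apply: Or32]; split=> //; lia.
- exists s, (e1 + e2 + q)%N, e1; split=> //.
  rewrite preimage_blowup_snd cE subst_sndE; congr (_ *: _).
  by rewrite !addn0 !add0n !expr0 !exprD; ring.
Qed.

(** Here the factor taken out is [-u^q], and the second chart, where [(f,g) = (uv,u)], carries the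
    cusp [u^p - v^q]. *)
Lemma blowup_snd_gt c p q : cusp_chart c q (p + q) -> (0 < q)%N ->
  torus_chart (blowup_fst c) p (p + q) /\ cusp_chart (blowup_snd c) p q.
Proof.
move=> [s [e1 [e2 [s0 cE cond]]]] q0; rewrite cusp_binomial in cE.
have ns0 : - s != 0 by rewrite oppr_eq0.
split.
- exists (- s), (e1 + e2 + q)%N, e2; split=> //.
  rewrite preimage_blowup_fst cE subst_fstE scaleNr -scalerN; congr (_ *: _).
  by rewrite !addn0 !add0n !expr0 !exprD; ring.
- exists (- s), (e1 + e2 + q)%N, e1; split=> //.
    rewrite preimage_blowup_snd cE subst_sndE scaleNr -scalerN; congr (_ *: _).
    by rewrite !addn0 !add0n !expr0 !exprD; ring.
  by case: cond => -[h1 h2]; [apply: Or31|apply: Or31|apply: Or32]; split=> //; lia.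
Qed.

Lemma cost_cusp_step p q N : (0 < p)%N -> (0 < q)%N -> coprime p q ->
  (forall c, cusp_chart c p q -> cost F c N) ->
  forall c, cusp_chart c (p + q) q \/ cusp_chart c q (p + q) -> cost F c N.+1.
Proof.
move=> p0 q0 cop IH c.
have cop1 : coprime p (p + q) by rewrite /coprime gcdnDl.
have cop2 : coprime q (p + q) by rewrite /coprime gcdnDr gcdnC.
case=> cE.
- have [c1 c2] := blowup_fst_gt cE q0.
  rewrite -[N]addn0; apply: cost_blowup (IH _ c1) (cost_torus_chart cop1 c2).
  apply: cusp_chart_unresolved cE => //; first by rewrite addn_gt0 p0.
  by rewrite coprime_sym.
- have [c1 c2] := blowup_snd_gt cE q0.
  rewrite -[N]add0n; apply: cost_blowup (cost_torus_chart cop1 c1) (IH _ c2).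
  by apply: cusp_chart_unresolved cE => //; rewrite addn_gt0 p0.
Qed.

(** Both orders of the exponents are carried along, because the second chart of a blow-up
    interchanges their roles. *)
Lemma cost_cusp_chart p q N : euclid_steps p q N ->
  forall c, cusp_chart c p q \/ cusp_chart c q p -> cost F c N.
Proof.
elim=> [c|{}p {}q {}N /euclid_steps_coprime[p0 q0 cop] IH c
        |{}p {}q {}N /euclid_steps_coprime[p0 q0 cop] IH c].
(* [f - g] becomes [-u (v - 1)] and [u (v - 1)]: two torus charts with exponents (0,1). *)
- suff: cusp_chart c 1 1 -> cost F c 1 by move=> H [].
  move=> cE; have [s [e1 [e2 [s0 cE' _]]]] := cE.
  rewrite cusp_binomial in cE'.
  apply: (@cost_blowup _ _ _ 0 0); first exact: cusp_chart_unresolved cE.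
  + apply: (@cost_torus_chart _ 0 1) => //; exists (- s), (e1 + e2).+1, e2.
    rewrite oppr_eq0; split=> //.
    rewrite preimage_blowup_fst cE' subst_fstE scaleNr -scalerN; congr (_ *: _).
    by rewrite !exprS !expr0; ring.
  + apply: (@cost_torus_chart _ 0 1) => //; exists s, (e1 + e2).+1, e1; split=> //.
    rewrite preimage_blowup_snd cE' subst_sndE; congr (_ *: _).
    by rewrite !exprS !expr0; ring.
- by apply: cost_cusp_step => // d dE; apply: IH; left.
- move=> cE; apply: (@cost_cusp_step q p) => //; first by rewrite coprime_sym.
    by move=> d dE; apply: IH; right.
  by rewrite addnC; case: cE; [right|left].
Qed.

End CuspCharts.

Theorem corollary4p6 (k : fieldType) (a b : nat) (ha : (1 < a)%N)
    (hb : (1 < b)%N) (hab : coprime a b) (d0 : int) (ds : seq int)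
    (hds : forall d, d \in ds -> 0 < d)
    (hcf : (a%:R / b%:R : rat) = cfrac d0 ds) :
  exists2 N : nat, N%:Z = d0 + \sum_(d <- ds) d
    & requires_exactly (X0 ^+ b - X1 ^+ a : plane_ring k) N.
Proof.
have [N NE st] := cfrac_euclid_steps (ltnW ha) (ltnW hb) hab hds hcf.
(* The steps run on [(a,b)], while the curve has exponents [(b,a)]. The plane has no exceptional
   components yet; the cusp is singular since both exponents exceed 1. *)
exists N => //; apply: cost_requires_exactly; apply: (cost_cusp_chart st); right.
exists 1, 0%N, 0%N; split; first exact: oner_neq0.
- by rewrite preimage_cusp scale1r !expr0 !mul1r.
- by apply: Or33.
Qed.
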